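(* Let $n\ge 2$ and $1\le t\le n-1$, and put $N=2^n-1$, $T=2^t-1$, $M=2^{n-t}-1$. Let $C$ be the binary code of length $N$ with parity check matrix $H_{n,t}$, and let $\mathcal{D}$ be the triple system on $V=\{1,\dots,N\}$ whose blocks are the supports of all codewords of weight $3$ in $C$. Then the number $s(n,t)$ of distinct Steiner triple systems on $V$ all of whose blocks are blocks of $\mathcal{D}$ (these have $2$-rank at most $N-n+t$) is $$s(n,t)=N_1(T)\cdot\big(N_2(T+1)\cdot T!\big)^M\cdot N_3(T+1)^{M(M-1)/6}.$$
   Context: $H_n$ denotes the $n\times(2^n-1)$ binary matrix whose columns are all the distinct nonzero vectors of $\mathrm{GF}(2)^n$. $H_{n,t}$ is the $(n-t)\times(2^n-1)$ matrix obtained from $H_n$ by deleting $t$ of its rows (arbitrarily chosen); its columns consist of every nonzero vector of $\mathrm{GF}(2)^{n-t}$ exactly $2^t$ times and the zero vector exactly $2^t-1$ times. $C=\{c\in\mathrm{GF}(2)^N: H_{n,t}c^{T}=0\}$. A Steiner triple system (STS) on a set $V$ is a collection of $3$-subsets (blocks) of $V$ such that every $2$-subset of $V$ lies in exactly one block; ''distinct'' means distinct as sets of blocks on the fixed labeled point set. $N_1(v)$ is the number of distinct Steiner triple systems on a fixed $v$-set. $N_2(2k)$ is the number of distinct $1$-factorizations of the complete graph on $2k$ fixed vertices. $N_3(g)$ is the number of distinct transversal designs $TD[3;g]$ on three fixed pairwise disjoint groups of size $g$, i.e. sets of $3$-subsets each meeting every group in exactly one point such that any two points from different groups lie in exactly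 one of these $3$-subsets. The $2$-rank of an STS is the rank over $\mathrm{GF}(2)$ of its block-by-point incidence matrix. *)

(* Defs.v *)
From mathcomp Require Import all_boot all_order all_algebra.

Set Implicit Arguments.
Unset Strict Implicit.
Unset Printing Implicit Defensive.

Import GRing.Theory.

(* The columns of H are all the nonzero vectors of GF(2)^n, each once; this
   fixes the matrix only up to the order of its columns. *)
Definition hamming_check (n N : nat) (H : 'M['F_2]_(n, N)) : Prop :=
  injective (fun j : 'I_N => col j H) /\
  (forall x : 'cV['F_2]_n, x != 0%R <-> exists j : 'I_N, col j H = x).

Definition delete_rows (n N : nat) (D : {set 'I_n}) (H : 'M['F_2]_(n, N)) :
    'M['F_2]_(#|~: D|, N) :=
  rowsub (fun i : 'I_#|~: D| => enum_val i) H.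

Definition code (m N : nat) (H : 'M['F_2]_(m, N)) : {set 'rV['F_2]_N} :=
  [set c | (H *m c^T)%R == 0%R].

Definition supp (N : nat) (c : 'rV['F_2]_N) : {set 'I_N} :=
  [set i | c ord0 i != 0%R].

Definition weight (N : nat) (c : 'rV['F_2]_N) : nat := #|supp c|.

Definition weight3_blocks (N : nat) (C : {set 'rV['F_2]_N}) :
    {set {set 'I_N}} :=
  [set supp c | c in C & weight c == 3].

Definition is_sts (V : finType) (B : {set {set V}}) : bool :=
  [forall b in B, #|b| == 3] &&
  [forall p : {set V}, (#|p| == 2) ==> (#|[set b in B | p \subset b]| == 1)].

Definition N1 (v : nat) : nat :=
  #|[set B : {set {set 'I_v}} | is_sts B]|.

Definition complete_edges (V : finType) : {set {set V}} :=
  [set e : {set V} | #|e| == 2].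

Definition is_1factor (V : finType) (f : {set {set V}}) : bool :=
  (f \subset complete_edges V) && partition f [set: V].

Definition is_1factorization (V : finType) (F : {set {set {set V}}}) : bool :=
  [forall f in F, is_1factor f] && partition F (complete_edges V).

(* The argument is the number of vertices 2k, not k. *)
Definition N2 (v : nat) : nat :=
  #|[set F : {set {set {set 'I_v}}} | is_1factorization F]|.

(* The three groups of the transversal design are the fibres {i} x [0, g[ of
   the first projection. *)
Definition td_group (g : nat) (i : 'I_3) : {set 'I_3 * 'I_g} :=
  [set x | x.1 == i].

Definition is_td3 (g : nat) (B : {set {set 'I_3 * 'I_g}}) : bool :=
  [forall b in B,
     (#|b| == 3) && [forall i : 'I_3, #|b :&: td_group g i| == 1]] &&
  [forall x : 'I_3 * 'I_g, forall y : 'I_3 * 'I_g, (x.1 != y.1) ==>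
     (#|[set b in B | [set x; y] \subset b]| == 1)].

Definition N3 (g : nat) : nat :=
  #|[set B : {set {set 'I_3 * 'I_g}} | is_td3 B]|.

Definition incidence_mx (v : nat) (B : {set {set 'I_v}}) : 'M['F_2]_(#|B|, v) :=
  (\matrix_(i, j) (j \in (enum_val i : {set 'I_v}))%:R)%R.

Definition rank2 (v : nat) (B : {set {set 'I_v}}) : nat :=
  \rank (incidence_mx B).

Definition sts_within (V : finType) (D : {set {set V}}) : {set {set {set V}}} :=
  [set B | is_sts B && (B \subset D)].

(* Main.v *)
(* Label each point by its column of the parity check matrix with rows deleted,
   a vector of W = GF(2)^(n-t).  The allowed triples are those whose labels sum to
   0, so the label set of an allowed block is determined by any pair p of its
   points, as { labels of p } together with their sum.  Hence being an STS is a
   separate condition on the blocks of each label set c, and the count is a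
   product over c.  For c = {0} one gets an STS on the T points labelled 0.  For
   c = {0, w} the third point labelled 0 labels the 1-factors of a 1-factorization
   of the T+1 points labelled w.  For c a line of PG(W) one gets a transversal
   design on three fibres of size T+1; there are M(M-1)/6 lines.  The rank bound
   holds because the incidence rows are codewords. *)
Require Import Defs.
From mathcomp Require Import all_boot all_order all_algebra.

Set Implicit Arguments.
Unset Strict Implicit.
Unset Printing Implicit Defensive.

Import GRing.Theory.

(** * Finite sets of one, two or three elements *)

Lemma card1P (S : finType) (A : {set S}) :
  reflect (exists2 x, x \in A & forall y, y \in A -> y = x) (#|A| == 1).
Proof.
apply: (iffP cards1P) => [[x ->]|[x xA Ax]].
  by exists x => [|y]; rewrite inE // => /eqP.
exists x; apply/setP=> y; rewrite !inE; apply/idP/eqP => [/Ax //|-> //].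
Qed.

Lemma cards3P (S : finType) (A : {set S}) (a : S) :
  #|A| = 3 -> a \in A ->
  exists x y, [/\ a != x, a != y, x != y & A = [set a; x; y]].
Proof.
move=> A3 aA; have /cards2P[x [y [xy E]]]: #|A :\ a| == 2.
  by have := cardsD1 a A; rewrite A3 aA add1n => -[<-].
have : x \in A :\ a by rewrite E !inE eqxx.
have : y \in A :\ a by rewrite E !inE eqxx orbT.
rewrite !inE => /andP[ya _] /andP[xa _].
exists x, y; split; rewrite 1?eq_sym //; first by rewrite eq_sym.
by rewrite -(setD1K aA) E setUA.
Qed.

Lemma set3C12 (S : finType) (a x y : S) : [set a; x; y] = [set x; a; y].
Proof. by rewrite [[set a; x]]setUC. Qed.

Lemma cards3 (S : finType) (a x y : S) :
  a != x -> a != y -> x != y -> #|[set a; x; y]| = 3.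
Proof.
by move=> ax ay xy; rewrite -setUA cardsU1 cards2 !inE negb_or ax ay xy.
Qed.

(** Serves twice in the count of lines: for pairs of nonzero vectors, and for pairs of points on one
    line. *)
Lemma card_off_diagonal (S : finType) (A : {set S}) :
  #|[set q : S * S | [&& q.1 \in A, q.2 \in A & q.1 != q.2]]| = #|A| * #|A|.-1.
Proof.
pose diag := [set q : S * S | q.1 == q.2].
have diagE : #|setX A A :&: diag| = #|A|.
  have dinj : injective (fun x : S => (x, x)) by move=> x y [].
  rewrite -(card_imset _ dinj); apply: eq_card => -[x y]; rewrite !inE /=.
  apply/andP/imsetP=> [[/andP[xA _] /eqP <-]|[z zA [-> ->]]]; first by exists x.
  by rewrite zA.
have offE : #|setX A A :\: diag| =
    #|[set q : S * S | [&& q.1 \in A, q.2 \in A & q.1 != q.2]]|.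
  by apply: eq_card => -[x y]; rewrite !inE /= andbC -andbA.
have := cardsID diag (setX A A); rewrite diagE offE cardsX.
by rewrite -subn1 mulnBr muln1 => <-; rewrite addKn.
Qed.

(** * 1-factorizations with labelled factors *)

Section LabelledFactorizations.
Variables T v : nat.
Hypothesis v_gt0 : 0 < v.

(** An index in ['I_T] stands for the point labelled 0 that completes each edge of its factor to a
    block. *)
Definition labelled_factorizations : {set {ffun 'I_T -> {set {set 'I_v}}}} :=
  [set h : {ffun 'I_T -> {set {set 'I_v}}} |
    injectiveb h && is_1factorization (h @: setT)].

(* v > 0 excludes the empty 1-factor, for which h need not be injective. *)
Lemma labelled_factorizationP (h : {ffun 'I_T -> {set {set 'I_v}}}) :
  reflect [/\ forall a e, e \in h a -> #|e| == 2,
              forall a x, #|[set e in h a | x \in e]| == 1 &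
              forall e : {set 'I_v}, #|e| == 2 -> #|[set a | e \in h a]| == 1]
          (h \in labelled_factorizations).
Proof.
rewrite inE; apply: (iffP andP) => [[/injectiveP h_inj]|[h1 h2 h3]].
  case/andP=> /forallP hf /and3P[/eqP hcov /trivIsetP htriv _].
  have {}hf a : is_1factor (h a).
    by have /implyP := hf (h a); apply; rewrite imset_f.
  split=> [a e ea|a x|e].
  - by have /andP[/subsetP/(_ e ea)] := hf a; rewrite inE.
  - have /andP[_ /and3P[/eqP acov /trivIsetP atriv _]] := hf a.
    have : x \in cover (h a) by rewrite acov.
    case/bigcupP=> e ea xe; apply/card1P; exists e; rewrite ?inE ?ea // => e'.
    rewrite inE => /andP[ea' xe']; apply: contraTeq isT => ne.
    have /pred0P/(_ x) := atriv e' e ea' ea ne.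
    by rewrite /= xe xe'.
  - move=> e2; have : e \in cover (h @: setT) by rewrite hcov inE.
    case/bigcupP=> _ /imsetP[a _ ->] ea; apply/card1P; exists a; rewrite ?inE // => a'.
    rewrite inE => ea'; apply: contraTeq isT => ne.
    have /pred0P/(_ e) : [disjoint h a' & h a].
      by rewrite htriv ?imset_f // (inj_eq h_inj).
    by rewrite /= ea ea'.
(* Every factor contains an edge and no edge lies in two factors; together these make [h]
   injective. *)
have h0 a : exists e, e \in h a.
  have /card1P[e] := h2 a (Ordinal v_gt0).
  by rewrite inE => /andP[ea _] _; exists e.
have h_uniq a a' e : e \in h a -> e \in h a' -> a = a'.
  move=> ea ea'; have /card1P[b _ bP] := h3 e (h1 a e ea).
  have -> : a = b by apply: bP; rewrite inE.
  by apply/esym/bP; rewrite inE.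
split.
  by apply/injectiveP=> a a' E; have [e ea] := h0 a; apply: (h_uniq _ _ e); rewrite -?E.
apply/andP; split.
  apply/forallP=> f; apply/implyP=> /imsetP[a _ ->]; apply/andP; split.
    by apply/subsetP=> e ea; rewrite inE (h1 a).
  apply/and3P; split.
  - rewrite eqEsubset subsetT; apply/subsetP=> x _.
    have /card1P[e] := h2 a x; rewrite inE => /andP[ea xe] _.
    by apply/bigcupP; exists e.
  - apply/trivIsetP=> e e' ea ea'; apply: contraNT => /pred0Pn[x /andP[/= xe xe']].
    have /card1P[e0 _ e0P] := h2 a x.
    have -> : e = e0 by apply: e0P; rewrite inE ea.
    by have -> : e' = e0 by apply: e0P; rewrite inE ea'.
  - by apply/negP=> /h1; rewrite cards0.
apply/and3P; split.
- apply/eqP/setP=> e; rewrite inE; apply/bigcupP/idP=> [[_ /imsetP[a _ ->] /h1 //]|e2].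
  have /card1P[a] := h3 e e2; rewrite inE => ea _.
  by exists (h a); rewrite ?imset_f.
- apply/trivIsetP=> _ _ /imsetP[a _ ->] /imsetP[a' _ ->]; apply: contraNT.
  by case/pred0Pn=> e /andP[/= ea ea']; rewrite (h_uniq a a' e).
- by apply/negP=> /imsetP[a _ E]; have [e] := h0 a; rewrite -E inE.
Qed.

End LabelledFactorizations.

(** Double counting: a 1-factor splits the v vertices into edges, so all factors have v/2 edges, and
    they split the v(v-1)/2 edges. *)
Lemma card_1factorization (v : nat) (F : {set {set {set 'I_v}}}) :
  1 < v -> is_1factorization F -> #|F| = v.-1.
Proof.
move=> v1 /andP[/forallP FF Fpart].
have fk (f : {set {set 'I_v}}) : f \in F -> v = #|f| * 2.
  move=> fF; have /implyP/(_ fF)/andP[/subsetP fe fpart] := FF f.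
  rewrite -(card_uniform_partition _ fpart) ?cardsT ?card_ord // => e /fe.
  by rewrite inE => /eqP.
have eC : #|complete_edges 'I_v| = 'C(v, 2) by rewrite card_draws card_ord.
(* An empty [F] would cover no edge, while edges exist because v > 1. *)
have [F0|[f fF]] := set_0Vmem F.
  have := eC; case/and3P: Fpart => /eqP <- _ _.
  rewrite F0 /cover big_set0 cards0 => /esym/eqP.
  by rewrite -leqn0 leqNgt bin_gt0 v1.
have v2 := fk _ fF.
have f0 : 0 < #|f| by rewrite -(ltn_pmul2r (ltn0Sn 1)) -v2 (ltn_trans _ v1).
have : 'C(v, 2) = #|F| * #|f|.
  rewrite -eC; apply: card_uniform_partition Fpart => f' /fk.
  by rewrite {1}v2 => /eqP; rewrite eqn_pmul2r // => /eqP.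
rewrite bin2 {1}v2 mulnAC muln2 doubleK mulnC.
by move/eqP; rewrite eqn_pmul2r // => /eqP.
Qed.

(** A 1-factorization of T+1 vertices has T factors, so the labellings with a given image are the T!
    bijections from the indices onto its factors. *)
Lemma card_labelled_factorizations (T : nat) :
  0 < T -> #|labelled_factorizations T T.+1| = N2 T.+1 * T`!.
Proof.
move=> T0; rewrite /N2 -sum1_card.
rewrite (partition_big (fun h : {ffun 'I_T -> _} => h @: setT)
  (fun F => F \in [set F : {set {set {set 'I_T.+1}}} | is_1factorization F]))
  /=; last first.
  by move=> h; rewrite !inE => /andP[].
rewrite -sum_nat_const; apply: eq_bigr => F; rewrite inE => F1.
have FT : #|F| = T by rewrite (card_1factorization _ F1).
(* T! becomes the falling factorial that counts injections of ['I_T] into [F]. *)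
rewrite sum1dep_card -ffactnn -[in X in _ = X ^_ _]FT -[X in _ = _ ^_ X](card_ord T).
rewrite -card_inj_ffuns_on; apply: eq_card => h; rewrite !inE.
apply/andP/andP=> [[/andP[hi _] /eqP <-]|[/ffun_onP hF hi]].
  by split=> //; apply/ffun_onP=> a; rewrite imset_f.
have /eqP E : h @: setT == F.
  rewrite eqEcard card_imset ?FT ?cardsT ?card_ord ?leqnn ?andbT; last exact/injectiveP.
  by apply/subsetP=> _ /imsetP[a _ ->]; apply: hF.
by rewrite E F1 hi.
Qed.
(** Numbers the points of a fibre, since [N1], [N2] and [N3] are defined on ordinals. *)
Lemma enum_set_inj (S : finType) (A : {set S}) (k : nat) :
  #|A| = k -> exists2 g : 'I_k -> S, injective g & g @: setT = A.
Proof.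
move=> <-; exists (fun i => enum_val i) => [i j|]; first exact: enum_val_inj.
apply/setP=> x; apply/imsetP/idP=> [[i _ ->]|xA]; first exact: enum_valP.
by exists (enum_rank_in xA x); rewrite ?inE ?enum_rankK_in.
Qed.

(** * Moving block systems along an injection *)

Section Transport.
Variables (U V : finType) (g : U -> V).
Hypothesis g_inj : injective g.

Definition blocks_imset (B : {set {set U}}) : {set {set V}} :=
  [set g @: b | b : {set U} in B].

Lemma imset_subset_inj (p b : {set U}) : (g @: p \subset g @: b) = (p \subset b).
Proof.
apply/idP/idP=> [/subsetP pb|]; last exact: imsetS.
by apply/subsetP=> x xp; rewrite -(mem_imset _ _ g_inj) pb ?imset_f.
Qed.

Lemma blocks_imset_inj : injective blocks_imset.
Proof. exact/imset_inj/imset_inj. Qed.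

Lemma mem_blocks_imset (B : {set {set U}}) (b : {set U}) :
  (g @: b \in blocks_imset B) = (b \in B).
Proof. exact: mem_imset (imset_inj g_inj). Qed.

Lemma card_blocks_above (B : {set {set U}}) (p : {set U}) :
  #|[set b in blocks_imset B | g @: p \subset b]| = #|[set b in B | p \subset b]|.
Proof.
rewrite -(card_imset _ (imset_inj g_inj)); apply: eq_card => b.
rewrite inE; apply/andP/imsetP=> [[/imsetP[b' Bb ->]]|[b']].
  by rewrite imset_subset_inj => pb; exists b'; rewrite ?inE ?Bb.
by rewrite inE => /andP[Bb pb] ->; rewrite mem_blocks_imset imset_subset_inj.
Qed.

Lemma sub_imset (b : {set V}) : b \subset g @: setT -> b = g @: (g @^-1: b).
Proof.
move=> /subsetP sb; apply/setP=> x; apply/idP/imsetP=> [xb|[y]].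
  by have /imsetP[y _ E] := sb x xb; exists y; rewrite ?inE -?E.
by rewrite inE => yb ->.
Qed.

Lemma blocks_imsetE (X : {set {set V}}) :
  (forall b, b \in X -> b \subset g @: setT) ->
  X = blocks_imset [set b : {set U} | g @: b \in X].
Proof.
move=> sX; apply/setP=> b; apply/idP/imsetP=> [bX|[b' + ->]]; last by rewrite inE.
by exists (g @^-1: b); rewrite ?inE -sub_imset ?sX.
Qed.

End Transport.

(** * Steiner triple systems inside the zero-sum triples of a labelling *)

Section Labelled.
Variables (V : finType) (W : finZmodType) (f : V -> W).
Hypothesis addWW : forall x : W, (x + x = 0)%R.

Local Open Scope ring_scope.

Let oppW (x : W) : - x = x.
Proof. by apply/eqP; rewrite eq_sym -subr_eq0 opprK addWW. Qed.

Let addW_eq0 (x y : W) : (x + y == 0) = (x == y).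
Proof. by rewrite -{1}(oppW y) subr_eq0. Qed.

Definition zero_triples : {set {set V}} :=
  [set b : {set V} | (#|b| == 3%N) && (\sum_(x in b) f x == 0)].

(* The label set of any block of zero_triples that contains the pair p. *)
Definition label_closure (p : {set V}) : {set W} :=
  (\sum_(x in p) f x) |: f @: p.

Lemma sum_set2 (x y : V) : x != y -> \sum_(z in [set x; y]) f z = f x + f y.
Proof. by move=> xy; rewrite big_setU1 ?inE //= big_set1. Qed.

Lemma sum_set3 (a x y : V) : a != x -> a != y -> x != y ->
  \sum_(z in [set a; x; y]) f z = f a + f x + f y.
Proof.
by move=> ax ay xy; rewrite -setUA big_setU1 ?inE ?negb_or ?ax //= sum_set2 // addrA.
Qed.

Lemma label_closure2 (x y : V) : x != y ->
  label_closure [set x; y] = [set f x + f y; f x; f y].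
Proof.
by move=> xy; rewrite /label_closure sum_set2 // imsetU1 imset_set1 setUA.
Qed.

(** If z is the point of the block outside p = {u, v}, the zero sum forces f z = f u + f v in
    characteristic 2. *)
Lemma label_closure_block (b p : {set V}) :
  b \in zero_triples -> p \subset b -> #|p| == 2%N -> f @: b = label_closure p.
Proof.
rewrite inE => /andP[/eqP b3 /eqP b0] pb /cards2P[x [y [xy pE]]].
have xb : x \in b by rewrite (subsetP pb) // pE !inE eqxx.
have yb : y \in b by rewrite (subsetP pb) // pE !inE eqxx orbT.
have [z zb zp] : exists2 z, z \in b & z \notin p.
  apply/subsetPn/negP=> /subset_leq_card.
  by rewrite b3 pE cards2 xy.
have /cards3P := b3; case/(_ z zb) => u [v [zu zv uv bE]].
have pE' : p = [set u; v].
  apply/eqP; rewrite eqEcard {2}pE !cards2 xy uv leqnn andbT; apply/subsetP=> w wp.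
  have := subsetP pb w wp; rewrite bE !inE -orbA => /orP[/eqP E|//].
  by rewrite E (negbTE zp) in wp *.
move: b0; rewrite bE sum_set3 // -addrA => /eqP; rewrite addW_eq0 => /eqP zE.
by rewrite pE' label_closure2 // -zE -setUA !imsetU1 imset_set1 setUA.
Qed.

(** * Splitting a system by label sets *)

(** Only pairs with closure [c] have to be covered here: by [label_closure_block], allowed blocks
    with label set [c] are the only ones that can cover them. *)
Definition local_systems (c : {set W}) : {set {set {set V}}} :=
  [set X : {set {set V}} |
    [forall b in X, (b \in zero_triples) && (f @: b == c)] &&
    [forall p : {set V}, (#|p| == 2%N) && (label_closure p == c) ==>
      (#|[set b in X | p \subset b]| == 1%N)]].

Lemma local_systemsP (c : {set W}) (X : {set {set V}}) :
  reflect ((forall b, b \in X -> b \in zero_triples /\ f @: b = c) /\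
           (forall p : {set V}, #|p| == 2%N -> label_closure p = c ->
              #|[set b in X | p \subset b]| == 1%N))
          (X \in local_systems c).
Proof.
rewrite inE; apply: (iffP andP) => [[/forallP P1 /forallP P2]|[P1 P2]]; split.
- by move=> b bX; have /implyP/(_ bX)/andP[-> /eqP] := P1 b.
- by move=> p p2 pc; have /implyP := P2 p; rewrite p2 pc eqxx; exact.
- by apply/forallP=> b; apply/implyP=> /P1[-> ->] /=.
- by apply/forallP=> p; apply/implyP=> /andP[p2 /eqP]; exact: P2.
Qed.

(** A system is cut into slices by label set. A pair p constrains only the slice at
    [label_closure p], so the slices can be chosen independently and glued. *)
Lemma card_sts_within_prod :
  #|sts_within zero_triples| = (\prod_(c : {set W}) #|local_systems c|)%N.
Proof.
pose Theta (B : {set {set V}}) : {ffun {set W} -> {set {set V}}} :=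
  [ffun c => [set b in B | f @: b == c]].
have Theta_inj : injective Theta.
  move=> B B' /ffunP E; apply/setP=> b; have := E (f @: b).
  by rewrite !ffunE => /setP/(_ b); rewrite !inE eqxx !andbT.
rewrite -(card_imset _ Theta_inj).
transitivity #|family (fun c => mem (local_systems c))|; last first.
  by rewrite card_family foldrE big_image.
apply: eq_card => F; apply/imsetP/familyP=> [[B + ->] c|Floc].
  rewrite inE => /andP[/andP[_ /forallP Bsts] /subsetP BD].
  rewrite ffunE; apply/local_systemsP; split=> [b|p p2 pc].
    by rewrite inE => /andP[/BD ? /eqP].
  have /implyP/(_ p2)/eqP <- := Bsts p; apply/eqP/eq_card=> b.
  rewrite !inE; case bB: (b \in B) => //=; case pb: (p \subset b); rewrite ?andbF //.
  by rewrite (label_closure_block (BD b bB) pb p2) pc eqxx.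
have FE c b : b \in F c -> b \in zero_triples /\ f @: b = c.
  by have /local_systemsP[+ _] := Floc c; exact.
(* A block of the union can come only from the slice of its own label set. *)
have BE b : (b \in \bigcup_c F c) = (b \in F (f @: b)).
  apply/bigcupP/idP=> [[c _ bF]|bF]; last by exists (f @: b).
  by have [_ ->] := FE _ _ bF.
exists (\bigcup_c F c).
  rewrite inE -andbA; apply/and3P; split.
  - by apply/forallP=> b; apply/implyP; rewrite BE => /FE[]; rewrite inE => /andP[].
  - apply/forallP=> p; apply/implyP=> p2.
    have /local_systemsP[_ /(_ p p2 erefl)/eqP <-] := Floc (label_closure p).
    apply/eqP/eq_card=> b; rewrite !inE BE.
    case pb: (p \subset b); rewrite ?andbF ?andbT //.
    apply/idP/idP=> bF; have [bD E] := FE _ _ bF.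
      by rewrite -(label_closure_block bD pb p2).
    by rewrite (label_closure_block bD pb p2).
  - by apply/subsetP=> b; rewrite BE => /FE[].
apply/ffunP=> c; rewrite ffunE; apply/setP=> b; rewrite inE BE.
apply/idP/andP=> [bF|[bF /eqP <-] //].
by have [_ E] := FE _ _ bF; rewrite E eqxx.
Qed.

Lemma label_closure_sub (p : {set V}) : f @: p \subset label_closure p.
Proof. exact: subsetUr. Qed.

(** All blocks of the class of [c], and all pairs with closure [c], lie in the preimage of [c],
    which [g] identifies with [U]. *)
Lemma card_local_transport (U : finType) (g : U -> V) (c : {set W}) :
  injective g -> g @: setT = f @^-1: c ->
  #|local_systems c| = #|[set B : {set {set U}} |
    [forall b in B, (g @: (b : {set U}) \in zero_triples) && (f @: (g @: b) == c)] &&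
    [forall p : {set U}, (#|p| == 2%N) && (label_closure (g @: p) == c) ==>
      (#|[set b in B | p \subset b]| == 1%N)]]|.
Proof.
move=> g_inj gT; rewrite -[RHS](card_imset _ (blocks_imset_inj g_inj)).
have subT (p : {set V}) : f @: p \subset c -> p \subset g @: setT.
  by rewrite gT sub_imset_pre.
apply: eq_card => X; apply/local_systemsP/imsetP=> [[X1 X2]|[B + ->]].
  have XE : X = blocks_imset g [set b : {set U} | g @: b \in X].
    by apply: blocks_imsetE => b /X1[_ E]; apply: subT; rewrite E.
  exists [set b : {set U} | g @: b \in X] => //; rewrite inE; apply/andP; split.
    apply/forallP=> b; apply/implyP; rewrite inE => /X1[-> ->]; exact: eqxx.
  apply/forallP=> p; apply/implyP=> /andP[p2 /eqP pc].
  by rewrite -(card_blocks_above g_inj) -XE X2 // card_imset.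
rewrite inE => /andP[/forallP B1 /forallP B2]; split.
  by move=> _ /imsetP[b bB ->]; have /implyP/(_ bB)/andP[? /eqP] := B1 b.
move=> p p2 pc; have pE : p = g @: (g @^-1: p).
  by apply/sub_imset/subT; rewrite -pc label_closure_sub.
rewrite pE (card_blocks_above g_inj).
have /implyP -> // := B2 (g @^-1: p).
by rewrite -(card_imset _ g_inj) -pE p2 pc eqxx.
Qed.

(** * The class {0} *)

(** On the fibre over 0 all label sums vanish and every nonempty set has label set {0}, so only the
    STS axioms remain. *)
Lemma card_local_systems0 (T : nat) :
  #|f @^-1: [set 0]| = T -> #|local_systems [set 0]| = N1 T.
Proof.
move=> /enum_set_inj[g g_inj gT].
have fg i : f (g i) = 0.
  have : g i \in f @^-1: [set 0] by rewrite -gT imset_f.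
  by rewrite !inE => /eqP.
have sumg (b : {set 'I_T}) : \sum_(x in g @: b) f x = 0.
  by apply: big1 => x /imsetP[i _ ->].
have imgg (b : {set 'I_T}) : b != set0 -> f @: (g @: b) = [set 0].
  case/set0Pn=> i ib; apply/setP=> x; rewrite inE; apply/imsetP/eqP => [[y]|->].
    by case/imsetP=> j _ -> ->.
  by exists (g i); rewrite ?imset_f.
rewrite (card_local_transport g_inj gT); apply: eq_card => B; rewrite !inE.
congr (_ && _); apply: eq_forallb => b.
  rewrite inE sumg card_imset // eqxx andbT.
  by case b3: (#|b| == 3%N); rewrite // imgg ?eqxx // -card_gt0 (eqP b3).
case b2: (#|b| == 2%N); rewrite //= /label_closure sumg imgg ?setUid ?eqxx //.
by rewrite -card_gt0 (eqP b2).
Qed.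

(** * The classes that are lines *)

(** These are the nonzero vectors of a 2-dimensional subspace of [W], regarded as a space over
    GF(2). *)
Definition line (c : {set W}) : bool :=
  [&& #|c| == 3%N, 0 \notin c & \sum_(x in c) x == 0].

Lemma lineE (c : {set W}) (x y : W) :
  line c -> x \in c -> y \in c -> x != y -> [set x + y; x; y] = c.
Proof.
case/and3P=> /eqP c3 _ /eqP c0 xc yc xy.
have [u [v [xu xv uv cE]]] := cards3P c3 xc.
have {}c0 : x + u + v = 0.
  by rewrite -c0 cE -setUA !big_setU1 ?inE ?negb_or ?xu //= big_set1 addrA.
move: yc; rewrite cE !inE eq_sym (negbTE xy) /= => /orP[]/eqP->.
  have -> : x + u = v by apply/eqP; rewrite -addW_eq0 c0.
  by rewrite -setUA setUC.
have -> : x + v = u by apply/eqP; rewrite -addW_eq0 addrAC c0.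
by rewrite set3C12.
Qed.

(** The fibres over the three points of [c] are the groups. Over [c], the allowed triples with label
    set [c] are those meeting each group once, and a pair has closure [c] exactly when its points
    lie in different groups. *)
Lemma card_local_systems_line (v : nat) (c : {set W}) :
  (forall w, w != 0 -> #|f @^-1: [set w]| = v) -> line c ->
  #|local_systems c| = N3 v.
Proof.
move=> fv lc; have /and3P[/eqP c3 c0 csum] := lc.
have [h h_inj hT] := enum_set_inj c3.
have hc i : h i \in c by rewrite -hT imset_f.
have h0 i : h i != 0 by apply: contraNneq c0 => <-.
have /fin_all_exists2[k k_inj kT] (i : 'I_3) :
    exists2 k : 'I_v -> V, injective k & k @: setT = f @^-1: [set h i].
  exact/enum_set_inj/fv.
(* Numberings of the three fibres combine into one numbering of all points with label in [c]. *)
pose g (x : 'I_3 * 'I_v) := k x.1 x.2.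
have fg x : f (g x) = h x.1.
  have : g x \in f @^-1: [set h x.1].
    by rewrite -kT; apply/imsetP; exists x.2.
  by rewrite !inE => /eqP.
have g_inj : injective g.
  move=> [i a] [j b] E; have := fg (i, a); rewrite E fg /= => /h_inj ij.
  by move: E; rewrite -ij /g /= => /k_inj ->.
have gT : g @: setT = f @^-1: c.
  apply/setP=> x; rewrite inE; apply/imsetP/idP=> [[y _ ->]|]; first by rewrite fg.
  rewrite -hT => /imsetP[i _ fx].
  have : x \in f @^-1: [set h i] by rewrite !inE fx.
  by rewrite -kT => /imsetP[a _ ->]; exists (i, a).
have fgs (b : {set 'I_3 * 'I_v}) : f @: (g @: b) = h @: (fst @: b).
  by rewrite -!imset_comp; apply: eq_imset => x /=; rewrite fg.
rewrite (card_local_transport g_inj gT); apply: eq_card => B; rewrite !inE.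
congr (_ && _).
  apply: eq_forallb => b; congr (_ ==> _); rewrite inE fgs card_imset // -hT.
  rewrite (inj_eq (imset_inj h_inj)) -andbA.
  case b3: (#|b| == 3%N) => //=; apply/andP/forallP=> [[_ /eqP bT] i|bi].
    have fst_inj : {in b &, injective fst}.
      by apply/imset_injP; rewrite bT cardsT card_ord (eqP b3).
    have : i \in fst @: b by rewrite bT inE.
    case/imsetP=> x xb iE; apply/card1P; exists x; rewrite ?inE ?xb ?iE ?eqxx //.
    by move=> y; rewrite !inE => /andP[yb /eqP]; apply: fst_inj.
  have bT : fst @: b = setT.
    apply/setP=> i; rewrite inE; have /card1P[x] := bi i.
    by rewrite !inE => /andP[xb /eqP <-] _; rewrite imset_f.
  have fst_inj : {in b &, injective fst}.
    by apply/imset_injP; rewrite bT cardsT card_ord (eqP b3).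
  (* As [fst] maps b bijectively onto the three groups, the label sum over b is the sum of the
     points of the line. *)
  rewrite bT; split=> //; rewrite big_imset /=; last by move=> ? ? _ _ /g_inj.
  under eq_bigr do rewrite fg.
  rewrite -(big_imset h fst_inj) bT -[X in X == 0]/(\sum_(i in setT) h i).
  by rewrite -(big_imset id) ?hT //; move=> ? ? _ _ /h_inj.
(* Two points with equal labels have 0 in their closure, and a line omits 0. *)
have gxy x y : x != y -> (label_closure (g @: [set x; y]) == c) = (x.1 != y.1).
  move=> xy; rewrite imsetU1 imset_set1 label_closure2 ?(inj_eq g_inj) // !fg.
  case: (eqVneq x.1 y.1) => [<-|xy1] /=; last first.
    by rewrite (lineE lc) ?(inj_eq h_inj) // eqxx.
  by apply: contraNF c0 => /eqP <-; rewrite addWW !inE eqxx.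
apply/forallP/forallP=> [Bp x|Bx p].
  apply/forallP=> y; apply/implyP=> xy1.
  have xy : x != y by apply: contraNneq xy1 => ->.
  by have /implyP -> // := Bp [set x; y]; rewrite cards2 xy gxy.
apply/implyP=> /andP[/cards2P[x [y [xy ->]]]]; rewrite gxy // => xy1.
by have /forallP/(_ y)/implyP -> := Bx x.
Qed.

(** * The classes {0, w} *)

Section MixedClass.
Variables (T v : nat) (w : W) (g0 : 'I_T -> V) (gw : 'I_v -> V).
Hypotheses (w0 : w != 0) (g0_inj : injective g0) (gw_inj : injective gw).
Hypotheses (g0T : g0 @: setT = f @^-1: [set 0]) (gwT : gw @: setT = f @^-1: [set w]).

Let fg0 a : f (g0 a) = 0.
Proof.
have : g0 a \in f @^-1: [set 0] by rewrite -g0T imset_f.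
by rewrite !inE => /eqP.
Qed.

Let fgw x : f (gw x) = w.
Proof.
have : gw x \in f @^-1: [set w] by rewrite -gwT imset_f.
by rewrite !inE => /eqP.
Qed.

Let g0P x : f x = 0 -> exists a, x = g0 a.
Proof.
move=> fx; have : x \in f @^-1: [set 0] by rewrite !inE fx.
by rewrite -g0T => /imsetP[a _ ->]; exists a.
Qed.

Let gwP x : f x = w -> exists a, x = gw a.
Proof.
move=> fx; have : x \in f @^-1: [set w] by rewrite !inE fx.
by rewrite -gwT => /imsetP[a _ ->]; exists a.
Qed.

Let g0w a x : g0 a != gw x.
Proof. by apply: contraNneq w0 => E; rewrite -(fgw x) -E fg0. Qed.

(** Labels 0, 0, w would sum to w, so an allowed block with label set {0, w} has one apex labelled 0
    over an edge labelled w. *)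
Definition cone (a : 'I_T) (e : {set 'I_v}) : {set V} := g0 a |: gw @: e.

Let g0_cone a a' e : (g0 a \in cone a' e) = (a == a').
Proof.
rewrite !inE (inj_eq g0_inj); case: eqVneq => //= _.
by apply/negP=> /imsetP[x _ E]; have := g0w a x; rewrite E eqxx.
Qed.

Let gw_cone x a e : (gw x \in cone a e) = (x \in e).
Proof. by rewrite !inE eq_sym (negbTE (g0w a x)) mem_imset. Qed.

Let cone_inj a a' e e' : cone a e = cone a' e' -> a = a' /\ e = e'.
Proof.
move=> E; split; first by apply/eqP; rewrite -(g0_cone _ _ e') -E g0_cone.
by apply/setP=> x; rewrite -(gw_cone x a) E gw_cone.
Qed.

Let gw_sub_cone (e : {set 'I_v}) a (e' : {set 'I_v}) :
  (gw @: e \subset cone a e') = (e \subset e').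
Proof.
apply/idP/idP=> [/subsetP s|s]; last by rewrite subsetU // imsetS ?orbT.
by apply/subsetP=> x xe; rewrite -(gw_cone x a) s ?imset_f.
Qed.

Let card_cone a e : #|cone a e| = #|e|.+1.
Proof.
rewrite cardsU1 card_imset //; case: imsetP => // -[x _ E].
by have := g0w a x; rewrite E eqxx.
Qed.

Definition cones (h : {ffun 'I_T -> {set {set 'I_v}}}) : {set {set V}} :=
  [set cone q.1 q.2 | q in [set q : 'I_T * {set 'I_v} | q.2 \in h q.1]].

Let conesP (h : {ffun 'I_T -> {set {set 'I_v}}}) b :
  reflect (exists a e, e \in h a /\ b = cone a e) (b \in cones h).
Proof.
apply: (iffP imsetP) => [[[a e]]|[a [e [ea ->]]]].
  by rewrite inE => /= ea ->; exists a, e.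
by exists (a, e); rewrite ?inE.
Qed.

Let mem_cones (h : {ffun 'I_T -> {set {set 'I_v}}}) a e :
  (cone a e \in cones h) = (e \in h a).
Proof.
apply/conesP/idP=> [[a' [e' [ea' /cone_inj[-> ->]]]] //|ea].
by exists a, e.
Qed.

Let cones_inj : injective cones.
Proof.
by move=> h h' E; apply/ffunP=> a; apply/setP=> e; rewrite -!mem_cones E.
Qed.

(** A cone above e has e itself as its base, by size; covering e once thus says that e lies in
    exactly one factor. *)
Let card_cones_above_edge (h : {ffun 'I_T -> {set {set 'I_v}}}) (e : {set 'I_v}) :
  (forall a e, e \in h a -> #|e| == 2%N) ->
  #|e| == 2%N -> #|[set b in cones h | gw @: e \subset b]| = #|[set a | e \in h a]|.
Proof.
move=> h2 e2; have cone_injl : injective (cone^~ e) by move=> a a' /cone_inj[].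
rewrite -(card_imset _ cone_injl); apply: eq_card => b; rewrite inE.
apply/andP/imsetP=> [[/conesP[a [e' [ea' ->]]]]|[a + ->]].
  rewrite gw_sub_cone => ee'; have E : e = e'.
    by apply/eqP; rewrite eqEcard ee' (eqP e2) (eqP (h2 _ _ ea')).
  by exists a; rewrite ?inE E.
by rewrite inE => ea; rewrite mem_cones gw_sub_cone ea.
Qed.

(** Covering this pair once says that exactly one edge of the factor [h a] passes through x. *)
Let card_cones_above_mixed (h : {ffun 'I_T -> {set {set 'I_v}}}) a x :
  #|[set b in cones h | [set g0 a; gw x] \subset b]| = #|[set e in h a | x \in e]|.
Proof.
have cone_injr : injective (cone a) by move=> e e' /cone_inj[].
rewrite -(card_imset _ cone_injr); apply: eq_card => b; rewrite inE.
rewrite subUset !sub1set.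
apply/and3P/imsetP=> [[/conesP[a' [e' [ea' ->]]]]|[e + ->]].
  rewrite g0_cone gw_cone => /eqP -> xe'; by exists e'; rewrite // inE ea'.
by rewrite inE => /andP[ea xe]; rewrite mem_cones g0_cone gw_cone.
Qed.

Let cone_block a (e : {set 'I_v}) : #|e| == 2%N ->
  cone a e \in zero_triples /\ f @: cone a e = [set 0; w].
Proof.
move=> e2; have /cards2P[x [y [xy eE]]] := e2.
have cE : cone a e = [set g0 a; gw x; gw y].
  by rewrite /cone eE imsetU1 imset_set1 setUA.
split.
  rewrite inE card_cone (eqP e2) eqxx cE sum_set3 ?(inj_eq gw_inj) //.
  by rewrite fg0 !fgw add0r addWW eqxx.
by rewrite cE !imsetU !imset_set1 fg0 !fgw -setUA setUid.
Qed.

Let block_cone (b : {set V}) : b \in zero_triples -> f @: b = [set 0; w] ->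
  exists a (e : {set 'I_v}), #|e| == 2%N /\ b = cone a e.
Proof.
rewrite inE => /andP[/eqP b3 /eqP b0] fb.
have : 0 \in f @: b by rewrite fb !inE eqxx.
case/imsetP=> z zb /esym fz; have [x [y [zx zy xy bE]]] := cards3P b3 zb.
have : w \in f @: b by rewrite fb !inE eqxx orbT.
(* The zero sum gives x and y equal labels, which must be w because w occurs on the block. *)
move: b0; rewrite bE sum_set3 // fz add0r => /eqP; rewrite addW_eq0 => /eqP fxy.
rewrite !imsetU !imset_set1 fz fxy -setUA setUid !inE (negbTE w0) /= => /eqP/esym fy.
have [a za] := g0P fz; have [i xi] := gwP (etrans fxy fy); have [j yj] := gwP fy.
exists a, [set i; j]; rewrite /cone imsetU1 imset_set1 cards2 -setUA za xi yj.
by move: xy; rewrite xi yj (inj_eq gw_inj) => ->.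
Qed.

Let closure_edge (e : {set 'I_v}) : #|e| == 2%N ->
  label_closure (gw @: e) = [set 0; w].
Proof.
case/cards2P=> x [y [xy ->]]; rewrite imsetU1 imset_set1.
by rewrite label_closure2 ?(inj_eq gw_inj) // !fgw addWW -setUA setUid.
Qed.

Let closure_mixed a x : label_closure [set g0 a; gw x] = [set 0; w].
Proof.
by rewrite label_closure2 // fg0 fgw add0r setUAC setUid setUC.
Qed.

Let closure_cases (p : {set V}) : #|p| == 2%N -> label_closure p = [set 0; w] ->
  (exists2 e : {set 'I_v}, #|e| == 2%N & p = gw @: e) \/
  (exists a x, p = [set g0 a; gw x]).
Proof.
case/cards2P=> x [y [xy ->]]; rewrite label_closure2 // => pc.
have : f x \in [set 0; w] by rewrite -pc !inE eqxx orbT.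
have : f y \in [set 0; w] by rewrite -pc !inE eqxx !orbT.
have : w \in [set f x + f y; f x; f y] by rewrite pc !inE eqxx orbT.
rewrite !inE => wxy /orP[]/eqP fy /orP[]/eqP fx.
(* Two points labelled 0 have closure {0}, which misses w. *)
- by move: wxy; rewrite fx fy addr0 (negbTE w0).
- by right; have [i ->] := gwP fx; have [a ->] := g0P fy; exists a, i; rewrite setUC.
- by right; have [i ->] := gwP fy; have [a ->] := g0P fx; exists a, i.
- left; have [i xi] := gwP fx; have [j yj] := gwP fy; exists [set i; j].
    by move: xy; rewrite cards2 xi yj (inj_eq gw_inj) => ->.
  by rewrite imsetU1 imset_set1 xi yj.
Qed.

(** [cones] is a bijection: pairs with closure {0, w} are edges or mixed pairs, and covering both
    kinds once gives the conditions of [labelled_factorizationP]. *)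
Lemma card_local_systems_mixed : (0 < v)%N ->
  #|local_systems [set 0; w]| = #|labelled_factorizations T v|.
Proof.
move=> v0; rewrite -[RHS](card_imset _ cones_inj); apply: eq_card => X.
apply/local_systemsP/imsetP=> [[X1 X2]|[h + ->]].
  (* The factor with index a is the link of the point [g0 a] in X. *)
  pose h := [ffun a => [set e | cone a e \in X]].
  have XE : X = cones h.
    apply/setP=> b; apply/idP/conesP=> [bX|[a [e [+ ->]]]].
      have [/block_cone + fb] := X1 _ bX => /(_ fb)[a [e [_ bE]]].
      by exists a, e; rewrite ffunE inE -bE.
    by rewrite ffunE inE.
  exists h => //; apply/(labelled_factorizationP v0).
  have h2 a e : e \in h a -> #|e| == 2%N.
    by rewrite ffunE inE => /X1[]; rewrite inE card_cone eqSS => /andP[].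
  split=> // [a x|e e2].
    by rewrite -card_cones_above_mixed -XE X2 ?closure_mixed ?cards2 ?g0w.
  by rewrite -card_cones_above_edge // -XE X2 ?closure_edge ?card_imset.
case/(labelled_factorizationP v0)=> h2 hmix hedge; split.
  by move=> b /conesP[a [e [/h2 e2 ->]]]; apply: cone_block.
move=> p p2 /(closure_cases p2)[[e e2 ->]|[a [x ->]]].
  by rewrite card_cones_above_edge // hedge.
by rewrite card_cones_above_mixed.
Qed.

End MixedClass.

(** * Counting lines, and the remaining label sets *)

Let add_neq_l (x y : W) : y != 0 -> x + y != x.
Proof. by rewrite -{2}[x]addr0 (inj_eq (addrI x)). Qed.

Let add_neq_r (x y : W) : x != 0 -> x + y != y.
Proof. by rewrite addrC; apply: add_neq_l. Qed.

Lemma line_add (x y : W) : x != 0 -> y != 0 -> x != y -> line [set x + y; x; y].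
Proof.
move=> x0 y0 xy; apply/and3P; split.
- by rewrite cards3 ?add_neq_l ?add_neq_r.
- by rewrite !inE !negb_or ![0 == _]eq_sym addW_eq0 xy x0 y0.
- rewrite -setUA !big_setU1 ?inE ?negb_or ?add_neq_l ?add_neq_r //=.
  by rewrite big_set1 addWW.
Qed.

(** Each ordered pair of distinct nonzero vectors spans one line, and each line arises from 3 * 2
    such pairs. *)
Lemma card_lines : (#|[set c | line c]| * 6 = #|W|.-1 * #|W|.-2)%N.
Proof.
rewrite -(cardsC1 (0 : W)) -card_off_diagonal.
rewrite -sum_nat_const -[RHS]sum1_card.
rewrite (partition_big (fun q : W * W => [set q.1 + q.2; q.1; q.2])
  (fun c => c \in [set c | line c])) /=; last first.
  by move=> q; rewrite !inE => /and3P[q1 q2 q12]; apply: line_add.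
apply: eq_bigr => c; rewrite inE => lc; have /and3P[/eqP c3 c0 _] := lc.
rewrite sum1dep_card -[LHS]/(3 * 3.-1)%N -c3 -card_off_diagonal.
apply: eq_card => -[x y]; rewrite !inE /=; apply/and3P/andP=> [[xc yc xy]|].
  rewrite (lineE lc xc yc xy) eqxx xy !andbT; split=> //.
  by apply/andP; split; [apply: contraNneq c0 => <-|apply: contraNneq c0 => <-].
by case=> /and3P[_ _ xy] /eqP <-; rewrite !inE !eqxx !orbT.
Qed.

Let mixed_class : {set {set W}} := [set [set 0; w] | w in ~: [set (0 : W)]].

Let card_mixed_class : #|mixed_class| = #|W|.-1.
Proof.
rewrite card_in_imset ?cardsC1 // => w w'; rewrite !inE => w0 w'0 /setP/(_ w).
by rewrite !inE eqxx orbT (negbTE w0) => /esym/eqP.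
Qed.

(** Equal labels close to {0} or {0, w}; distinct labels close to {0, w} if one of them is 0, and to
    a line otherwise. *)
Lemma label_closure_class (p : {set V}) : #|p| == 2%N ->
  [|| label_closure p == [set 0], label_closure p \in mixed_class |
      line (label_closure p)].
Proof.
case/cards2P=> x [y [xy ->]]; rewrite label_closure2 //.
have mixed (w : W) : w != 0 -> [set 0; w] \in mixed_class.
  by move=> w0; apply/imsetP; exists w; rewrite ?inE.
case: (eqVneq (f x) (f y)) => [->|fxy].
  rewrite addWW -setUA setUid; case: (eqVneq (f y) 0) => [->|fy].
    by rewrite setUid eqxx.
  by rewrite mixed ?orbT.
case: (eqVneq (f x) 0) => [fx|fx].
  by rewrite fx add0r setUAC setUid setUC mixed ?orbT // -fx eq_sym.
case: (eqVneq (f y) 0) => [fy|fy].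
  by rewrite fy addr0 setUid setUC mixed ?orbT.
by rewrite line_add ?orbT.
Qed.

(** No pair has such a closure, so no allowed block has label set [c] and the empty system is the
    only one. *)
Lemma card_local_systems_other (c : {set W}) :
  c != [set 0] -> c \notin mixed_class -> ~~ line c -> #|local_systems c| = 1%N.
Proof.
move=> c0 cm cl; have closureN (p : {set V}) : #|p| == 2%N -> label_closure p <> c.
  by move=> /label_closure_class + pc; rewrite pc (negbTE c0) (negbTE cm) (negbTE cl).
apply/eqP/cards1P; exists set0; apply/setP=> X; rewrite inE.
apply/local_systemsP/eqP=> [[X1 _]|->].
  apply/setP=> b; rewrite inE; apply/negP=> /X1[bD bc].
  have /andP[/eqP b3 _] : (#|b| == 3%N) && (\sum_(x in b) f x == 0) by rewrite inE in bD.
  have /card_gt0P[a ab] : (0 < #|b|)%N by rewrite b3.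
  have [x [y [_ _ xy bE]]] := cards3P b3 ab.
  have xy2 : #|[set x; y]| == 2%N by rewrite cards2 xy.
  apply: (closureN _ xy2); rewrite -bc; apply/esym/label_closure_block => //.
  by rewrite bE -setUA subsetUr.
by split=> [b|p p2 /closureN]; [rewrite inE|case].
Qed.

Lemma card_sts_within_zero_triples (T : nat) : (0 < T)%N ->
  #|f @^-1: [set 0]| = T -> (forall w, w != 0 -> #|f @^-1: [set w]| = T.+1) ->
  #|sts_within zero_triples| =
    (N1 T * (N2 T.+1 * T`!) ^ #|W|.-1 * N3 T.+1 ^ (#|W|.-1 * #|W|.-2 %/ 6))%N.
Proof.
move=> T0 f0 fw; rewrite card_sts_within_prod -card_lines mulnK //.
have mixed2 (c : {set W}) : c \in mixed_class -> #|c| = 2%N.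
  by case/imsetP=> w; rewrite !inE => w0 ->; rewrite cards2 eq_sym w0.
have line3 (c : {set W}) : line c -> #|c| = 3%N by case/and3P=> /eqP.
(* The three classes consist of sets of sizes 1, 2 and 3, so at most one of the conditions holds for
   each c. *)
transitivity (\prod_(c : {set W}) ((if c == [set 0%R] then N1 T else 1) *
    (if c \in mixed_class then N2 T.+1 * T`! else 1) *
    (if c \in [set c | line c] then N3 T.+1 else 1)))%N; last first.
  rewrite !big_split /= -!big_mkcond /= big_pred1_eq !prod_nat_const.
  by rewrite card_mixed_class.
apply: eq_bigr => c _; rewrite inE.
case: (eqVneq c [set 0]) => [->|c0].
  rewrite (card_local_systems0 f0).
  case: ifP => [/mixed2|_]; first by rewrite cards1.
  by case: ifP => [/line3|_]; rewrite ?cards1 ?muln1.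
case: (boolP (c \in mixed_class)) => [cm|cm].
  case: ifP => [/line3|_]; first by rewrite mixed2.
  rewrite mul1n muln1 -card_labelled_factorizations //.
  case/imsetP: cm => w; rewrite !inE => w0 ->.
  have [g0 g0_inj g0T] := enum_set_inj f0.
  have [gw gw_inj gwT] := enum_set_inj (fw w w0).
  exact: (card_local_systems_mixed w0 g0_inj gw_inj).
case: ifP => [lc|/negbT lc]; first by rewrite !mul1n; apply: card_local_systems_line.
by rewrite card_local_systems_other.
Qed.

End Labelled.

(** * The code and its fibres *)

Section BinaryCode.
Local Open Scope ring_scope.

Lemma F2_neq0 (x : 'F_2) : x != 0 -> x = 1.
Proof. by case: x => -[|[|//]] // i _; apply/val_inj. Qed.

Lemma addxx_F2 (m n : nat) (A : 'M['F_2]_(m, n)) : A + A = 0.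
Proof.
by apply/matrixP=> i j; rewrite !mxE -mulr2n -mulr_natr [2%:R](_ : _ = 0) ?mulr0 //;
  apply/val_inj.
Qed.

(** A nonzero coefficient in GF(2) is 1, so a syndrome is a plain sum of columns. *)
Lemma mulmx_supp (m N : nat) (A : 'M['F_2]_(m, N)) (c : 'rV['F_2]_N) :
  A *m c^T = \sum_(j in supp c) col j A.
Proof.
apply/matrixP=> i k; rewrite (ord1 k) summxE mxE [RHS]big_mkcond /=.
apply: eq_bigr => j _.
by rewrite !mxE inE; case: eqP => [->|/eqP/F2_neq0 ->]; rewrite ?mulr0 ?mulr1.
Qed.

(** Every point set is the support of its indicator vector, so codewords of weight 3 amount to
    triples of columns with sum 0. *)
Lemma weight3_blocks_code (m N : nat) (A : 'M['F_2]_(m, N)) :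
  weight3_blocks (code A) = zero_triples (fun j => col j A).
Proof.
apply/setP=> b; rewrite inE; apply/imsetP/andP=> [[c]|[b3 b0]].
  by rewrite !inE mulmx_supp => /andP[c0 c3] ->.
pose c : 'rV['F_2]_N := \row_j (j \in b)%:R.
have cb : supp c = b by apply/setP=> j; rewrite inE mxE; case: (j \in b).
by exists c; rewrite // !inE /weight mulmx_supp cb b0.
Qed.

Section DeleteRows.
Variables (n : nat) (R : {set 'I_n}).

Lemma delete_rowsD (p : nat) : {morph @delete_rows n p R : x y / x + y}.
Proof. by move=> x y; apply/matrixP=> i j; rewrite !mxE. Qed.

Lemma delete_rows_surj (p : nat) (w : 'M['F_2]_(#|~: R|, p)) :
  exists x, delete_rows R x = w.
Proof.
(* The preimage is 0 on the deleted rows; matching on [boolP] supplies the membership proof that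
   [enum_rank_in] takes. *)
exists (\matrix_(i, j) if boolP (i \in ~: R) is AltTrue iR then
  w (enum_rank_in iR i) j else 0).
apply/matrixP=> i j; rewrite !mxE; case: {-}_ / boolP => [iR|].
  by rewrite enum_valK_in.
by rewrite enum_valP.
Qed.

(** Deleting rows is additive and surjective, so its fibres are translates of one another and share
    the 2^n vectors equally. *)
Lemma card_delete_rows_fibre (w : 'cV['F_2]_#|~: R|) :
  #|[set x : 'cV['F_2]_n | delete_rows R x == w]| = (2 ^ #|R|)%N.
Proof.
pose K (w : 'cV['F_2]_#|~: R|) := [set x : 'cV['F_2]_n | delete_rows R x == w].
have KE w' : #|K w'| = #|K w|.
  have [x0 x0E] := delete_rows_surj (w' - w).
  rewrite -[RHS](card_imset _ (addIr x0)); apply: eq_card => x.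
  rewrite inE; apply/eqP/imsetP=> [xE|[y + ->]].
    exists (x - x0); rewrite ?subrK // inE; apply/eqP/(addIr (w' - w)).
    by rewrite -{1}x0E -delete_rowsD subrK xE addrC subrK.
  by rewrite inE => /eqP yE; rewrite delete_rowsD yE x0E addrC subrK.
have : #|{: 'cV['F_2]_n}| = (\sum_w #|K w|)%N.
  rewrite -[LHS]sum1_card (partition_big (@delete_rows n 1 R) predT) //=.
  by apply: eq_bigr => w' _; rewrite sum1dep_card.
under eq_bigr do rewrite KE.
rewrite sum_nat_const !card_mx card_Fp // !muln1 => E.
apply/eqP; rewrite -(@eqn_pmul2l (2 ^ #|~: R|)) ?expn_gt0 // -/(K w) -E.
by rewrite -expnD addnC cardsC card_ord.
Qed.

(** The columns of [H] are all vectors except 0, and 0 lies over w = 0, so only that fibre loses a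
    point. *)
Lemma card_col_fibre (N : nat) (H : 'M['F_2]_(n, N)) (w : 'cV['F_2]_#|~: R|) :
  hamming_check H ->
  #|(fun j => col j (delete_rows R H)) @^-1: [set w]| = (2 ^ #|R| - (w == 0%R))%N.
Proof.
case=> H_inj H_surj; rewrite -(card_delete_rows_fibre w) -(card_imset _ H_inj).
have colE j : col j (delete_rows R H) = delete_rows R (col j H).
  by apply/matrixP=> i k; rewrite !mxE.
rewrite [X in _ = (X - _)%N](cardsD1 0) inE.
have -> : delete_rows R (0 : 'cV['F_2]_n) = 0 by apply/matrixP=> i j; rewrite !mxE.
rewrite eq_sym addKn; apply: eq_card => x; rewrite !inE.
apply/imsetP/andP=> [[j + ->]|[/H_surj[j <-] xw]].
  by rewrite !inE colE => ->; split=> //; apply/H_surj; exists j.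
by exists j; rewrite // !inE colE.
Qed.

End DeleteRows.

(** The incidence rows are codewords, and the code has dimension N - m because the columns of [A]
    exhaust the space. *)
Lemma rank2_code (m N : nat) (A : 'M['F_2]_(m, N)) (B : {set {set 'I_N}}) :
  (forall w : 'cV['F_2]_m, exists j, col j A = w) ->
  B \subset weight3_blocks (code A) -> (rank2 B <= N - m)%N.
Proof.
move=> A_surj /subsetP BA.
have A_free : row_free A.
  apply: inj_row_free => v vA; apply/rowP=> i; rewrite mxE.
  (* The column equal to the i-th unit vector reads off the i-th entry of v. *)
  have [j jE] := A_surj (delta_mx i 0).
  have : v *m col j A = 0 by rewrite colE mulmxA vA mul0mx.
  by rewrite jE -colE => /matrixP/(_ 0 0); rewrite !mxE.
rewrite -(eqP A_free) -(mxrank_tr A) leq_subRL; last by rewrite mxrank_tr rank_leq_col.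
rewrite addnC; apply: mulmx0_rank_max; apply/row_matrixP=> i.
rewrite row_mul row0 -[LHS]trmxK trmx_mul trmxK mulmx_supp.
have := BA _ (enum_valP i); rewrite weight3_blocks_code inE => /andP[_ /eqP].
have -> : supp (row i (incidence_mx B)) = enum_val i.
  by apply/setP=> j; rewrite inE !mxE; case: (j \in _).
by move=> ->; rewrite trmx0.
Qed.

End BinaryCode.

(** * The count and the rank bound for the shortened parity check matrix *)

Theorem theorem2p9 (n t : nat) (hn : 2 <= n) (ht1 : 1 <= t) (htn : t <= n - 1)
    (H : 'M['F_2]_(n, 2 ^ n - 1)) (hH : hamming_check H)
    (R : {set 'I_n}) (hR : #|R| = t) :
  let N := 2 ^ n - 1 in
  let T := 2 ^ t - 1 in
  let M := 2 ^ (n - t) - 1 in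
  let SD := sts_within (weight3_blocks (code (delete_rows R H))) in
  #|SD| = N1 T * (N2 (T + 1) * T`!) ^ M * N3 (T + 1) ^ (M * (M - 1) %/ 6) /\
  (forall B, B \in SD -> rank2 B <= N - n + t).
Proof.
move=> N T M SD.
have fibre w := card_col_fibre (R := R) w hH; rewrite hR in fibre.
have t2 : 1 < 2 ^ t by rewrite -{1}(expn0 2) ltn_exp2l.
have TS : T.+1 = 2 ^ t by rewrite /T subn1 prednK // ltnW.
have mE : #|~: R| = n - t by rewrite cardsCs setCK card_ord hR.
split.
  rewrite /SD weight3_blocks_code addn1 (@card_sts_within_zero_triples _ _ _ _ T).
  - by rewrite card_mx card_Fp // muln1 mE /M !subn1.
  - exact: addxx_F2.
  - by rewrite subn_gt0.
  - by rewrite fibre eqxx.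
  - by move=> w w0; rewrite fibre (negbTE w0) subn0.
move=> B; rewrite inE => /andP[_ BD].
(* With t <= n <= N, the truncated subtractions satisfy N - n + t = N - (n - t). *)
have tn : t <= n by rewrite (leq_trans htn) ?leq_subr.
have nN : n <= N by rewrite /N subn1 -ltnS prednK ?expn_gt0 // ltn_expl.
have -> : N - n + t = N - #|~: R| by rewrite mE subnBA // addnBAC.
(* Every vector occurs as a column; for w = 0 this uses 2^t - 1 > 0. *)
apply: rank2_code BD => w; have : 0 < #|(fun j => col j (delete_rows R H)) @^-1: [set w]|.
  by rewrite fibre subn_gt0; case: eqP => // _; rewrite ltnW.
by case/card_gt0P=> j; rewrite !inE => /eqP; exists j.
Qed.
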